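(* For each natural number $n\ge 1$, there is a caterpillar $C_n$ of order $n$ satisfying $$M_{C_n}>n-\lceil 2\log_2(n)\rceil-1.$$
   Context: The order of a graph is its number of vertices. A subtree of a tree $T$ is a nonempty connected subgraph. The mean subtree order $M_T$ is the average of the orders of all subtrees of $T$. A caterpillar is a tree for which deleting all leaves (vertices of degree at most $1$) leaves a path (possibly empty or a single vertex). *)

(* Defs.v *)
From HB Require Import structures.
From mathcomp Require Import all_boot all_order all_algebra.
From mathcomp Require Import reals exp.

Set Implicit Arguments.
Unset Strict Implicit.
Unset Printing Implicit Defensive.

Import Order.TTheory GRing.Theory Num.Theory.
Local Open Scope ring_scope.

(* Finite simple graphs whose vertex set is an arbitrary subset of an ambient
   finType T.  A graph is a pair (V, E), each edge being a 2-subset of V; so a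
   subgraph of a graph over T is again a graph over T, and the graphs over T
   form a finType, over which one can sum. *)
Definition is_sgraph (T : finType) (p : {set T} * {set {set T}}) : bool :=
  [forall e in p.2, (e \subset p.1) && (#|e| == 2)%N].

Record sgraph (T : finType) := SGraph {
  sgval : {set T} * {set {set T}};
  sgvalP : is_sgraph sgval }.

HB.instance Definition _ (T : finType) := [isSub for @sgval T].
HB.instance Definition _ (T : finType) := [Finite of sgraph T by <:].

Definition vertices (T : finType) (G : sgraph T) : {set T} := (sgval G).1.
Definition edges (T : finType) (G : sgraph T) : {set {set T}} := (sgval G).2.

Definition graph_order (T : finType) (G : sgraph T) : nat := #|vertices G|.

Definition adj (T : finType) (G : sgraph T) : rel T :=
  fun x y => [set x; y] \in edges G.

Definition vdegree (T : finType) (G : sgraph T) (x : T) : nat :=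
  #|[set y | adj G x y]|.

Definition subgraph (T : finType) (H G : sgraph T) : bool :=
  (vertices H \subset vertices G) && (edges H \subset edges G).

(* The empty graph is connected in this sense; nonemptiness is always required
   separately below. *)
Definition connected_graph (T : finType) (G : sgraph T) : bool :=
  [forall x in vertices G, forall y in vertices G, connect (adj G) x y].

Definition acyclic_graph (T : finType) (G : sgraph T) : Prop :=
  forall s : seq T, (3 <= size s)%N -> ~ ucycle (adj G) s.

Definition is_tree (T : finType) (G : sgraph T) : Prop :=
  [/\ vertices G != set0, connected_graph G & acyclic_graph G].

Definition subtree (T : finType) (S G : sgraph T) : bool :=
  [&& subgraph S G, vertices S != set0 & connected_graph S].

Definition mean_subtree_order (R : numFieldType) (T : finType) (G : sgraph T)
    : R :=
  (\sum_(S : sgraph T | subtree S G) (graph_order S)%:R)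
    / #|[set S : sgraph T | subtree S G]|%:R.

Definition is_path (T : finType) (G : sgraph T) : Prop :=
  exists s : seq T,
    [/\ uniq s,
        vertices G = [set:: s] &
        edges G = [set:: [seq [set p.1; p.2] | p <- zip s (behead s)]]].

Lemma del_vertices_subproof (T : finType) (G : sgraph T) (A : {set T}) :
  is_sgraph (vertices G :\: A, [set e in edges G | [disjoint e & A]]).
Proof.
apply/forall_inP => e /=; rewrite inE => /andP[eG eA].
have /forall_inP/(_ e eG)/andP[eV ->] := sgvalP G.
by rewrite andbT subsetD eV eA.
Qed.

Definition del_vertices (T : finType) (G : sgraph T) (A : {set T}) : sgraph T :=
  SGraph (del_vertices_subproof G A).

Definition leaves (T : finType) (G : sgraph T) : {set T} :=
  [set x in vertices G | (vdegree G x <= 1)%N].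

Definition caterpillar (T : finType) (G : sgraph T) : Prop :=
  is_tree G /\ is_path (del_vertices G (leaves G)).

Definition log2 (R : realType) (x : R) : R := ln x / ln 2.

(* Main.v *)
Require Import Defs.
From HB Require Import structures.
From mathcomp Require Import all_boot all_order all_algebra.
From mathcomp Require Import reals exp.
From mathcomp Require Import zify.

Set Implicit Arguments.
Unset Strict Implicit.
Unset Printing Implicit Defensive.

Import Order.TTheory GRing.Theory Num.Theory.
Local Open Scope ring_scope.

(** The caterpillars are double brooms: a path [0 - 1 - ... - q] (the spine)
with [a] leaves attached to its end [0] and [b] leaves attached to its end [q].
Put [s := ceil (2 log2 n)], so that [n ^ 2 <= 2 ^ s], and [t := n - s - 1].

When [n > 2 s], take [a = b = s].  The subtrees containing the whole spine
correspond to the subsets of the leaves: there are [4 ^ s] of them and their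
orders average [n - s = t + 1], which beats [t] by one each
([sum_spine_supersets]).  It remains to see that the other subtrees have a total
deficit with respect to [t] below [4 ^ s].  A subtree containing exactly one end
is an initial or final segment of the spine, of [i <= q] vertices, with some of
the [s] leaves at that end; these contribute at most
[2 * 2 ^ s * sum_(1 <= i <= q) (t - i) = 2 ^ s * q * (n - 2)], and the average
length [(q + 1) / 2] of such a segment cannot be neglected here, as the trivial
bound [t] on each deficit would lose a factor two.  A subtree containing no end
is a segment of the spine or a single leaf, so these number at most
[n * (q + 1)] and contribute [O(n ^ 3)].  As [2 ^ s >= n ^ 2], the sum of both
contributions is below [4 ^ s].

When [n <= 2 s], the star does it: its spine is one vertex, almost all its
subtrees contain the centre, and those have mean order [(n + 1) / 2 >= t + 1].
Both cases are instances of [broom_sum_gt].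

Subtrees are subgraphs, that is pairs of a vertex set and an edge set.  To count
them, the vertices are numbered so that every vertex except [0] has a smaller
parent.  In such a tree a subgraph is connected exactly when its vertex set
contains, with every vertex but the least one, also its parent, and when it has
all the edges between its vertices ([subtree_rooted]).  Sums over subtrees thus
become sums over such vertex sets ([rooted_subtree_sum]). *)

Local Open Scope nat_scope.

(** * Trees given by a parent function *)


Lemma adj_sym (T : finType) (G : sgraph T) : symmetric (adj G).
Proof. by move=> x y; rewrite /adj setUC. Qed.

Lemma edge_subset (T : finType) (G : sgraph T) (e : {set T}) :
  e \in edges G -> e \subset vertices G.
Proof. by move=> eG; have /forall_inP/(_ e eG)/andP[] := sgvalP G. Qed.

Lemma induced_subproof (T : finType) (G : sgraph T) (W : {set T}) :
  is_sgraph (W, [set e in edges G | e \subset W]).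
Proof.
apply/forall_inP => e /=; rewrite inE => /andP[eG ->] /=.
by have /forall_inP/(_ e eG)/andP[] := sgvalP G.
Qed.

Definition induced (T : finType) (G : sgraph T) (W : {set T}) : sgraph T :=
  SGraph (induced_subproof G W).

Section ParentTree.
Variables (N : nat) (p : 'I_N.+1 -> 'I_N.+1).
Hypothesis p_lt : forall x : 'I_N.+1, 0 < x -> p x < x.
Hypothesis p_root : p ord0 = ord0.

Lemma parent_leq (x : 'I_N.+1) : p x <= x.
Proof.
case: (posnP x) => [x0|/p_lt/ltnW//].
by rewrite (_ : x = ord0) ?p_root //; apply: val_inj.
Qed.

Lemma parent_neq (x : 'I_N.+1) : 0 < x -> x != p x.
Proof. by move=> /p_lt; rewrite -val_eqE /= => h; rewrite gtn_eqF. Qed.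

Lemma parent_tree_subproof :
  is_sgraph ([set: 'I_N.+1], [set [set x; p x] | x : 'I_N.+1 & 0 < x]).
Proof.
apply/forall_inP => e /= /imsetP[x]; rewrite inE => x0 ->.
by rewrite subsetT cards2 parent_neq.
Qed.

(** Only the values of [p] at positive vertices produce edges; that [0] is a
fixed point makes the iterates of [p] nonincreasing everywhere. *)
Definition parent_tree : sgraph 'I_N.+1 := SGraph parent_tree_subproof.

Notation G := parent_tree.

Lemma parent_tree_edgeP (e : {set 'I_N.+1}) :
  reflect (exists2 x : 'I_N.+1, 0 < x & e = [set x; p x]) (e \in edges G).
Proof.
apply: (iffP imsetP) => [[x]|[x x0 ->]]; first by rewrite inE; exists x.
by exists x; rewrite ?inE.
Qed.

Lemma parent_tree_adjP (x y : 'I_N.+1) :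
  reflect ((0 < x /\ y = p x) \/ (0 < y /\ x = p y)) (adj G x y).
Proof.
apply: (iffP (parent_tree_edgeP _)) => [[u u0 exy]|[[x0 ->]|[y0 ->]]].
- have: u \in [set x; y] by rewrite exy set21.
  have: p u \in [set x; y] by rewrite exy set22.
  have := parent_neq u0.
  by move=> upu; rewrite !inE => /orP[] /eqP pu /orP[] /eqP uu;
    move: upu; rewrite pu uu ?eqxx // => _; [right|left]; rewrite -uu.
- by exists x.
- by exists y; rewrite // setUC.
Qed.

(** The edge from [x] to its parent is the only one of the tree that leaves the
set of descendants of [x].  Descendants of [x] are at least [x], so a connected
subgraph containing [x] and a smaller vertex must use this edge. *)
Lemma edge_to_parent (S : sgraph 'I_N.+1) (r x : 'I_N.+1) :
  subgraph S G -> connected_graph S ->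
  r \in vertices S -> x \in vertices S -> r < x -> [set x; p x] \in edges S.
Proof.
move=> /andP[_ /subsetP sE] /forall_inP cS rS xS rx.
have /forall_inP/(_ r rS) cxr := cS x xS.
apply: contraLR rx => nE; rewrite -leqNgt.
have clos : closed (adj S) [pred y | fconnect p y x].
  (* The descendants of x are the u with fconnect p u x: once the edge above x
     is missing, being a descendant is invariant along the edges of S. *)
  have up u : u != x -> fconnect p u x = fconnect p (p u) x.
    move=> ux; apply/idP/idP => [/connectP[[|v s] /=]|]; last first.
    - exact/connect_trans/fconnect1.
    - by move=> /andP[/eqP -> ps] xl; apply/connectP; exists s.
    - by move=> _ xu; rewrite xu eqxx in ux.
  move=> u v uv; rewrite !inE.
  have /parent_tree_adjP[[u0 vu]|[v0 uv']] : adj G u v by apply: sE.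
  - rewrite vu -up //; apply: contraNneq nE => <-; by rewrite -vu.
  - rewrite uv' -up //; apply: contraNneq nE => <-; by rewrite -uv' setUC.
have := closed_connect clos cxr; rewrite !inE connect0 => /esym rx.
have iter_le i : iter i p r <= r.
  by elim: i => //= i /(leq_trans _)-> //; apply: parent_leq.
by rewrite -(iter_findex rx).
Qed.

(** [r] is both the least vertex of [W] and the top of [W] for the parent
order; asking for [r < x] is what identifies the two. *)
Definition rooted (W : {set 'I_N.+1}) : bool :=
  [exists r in W, [forall x in W, (x == r) || (r < x) && (p x \in W)]].

(** By [edge_to_parent], a subtree contains the edge from each of its vertices
but the least to its parent, and these are all the edges of the tree between its
vertices.  Conversely, following parents leads from any vertex of a rooted set
to its root. *)
Lemma subtree_rooted (S : sgraph 'I_N.+1) :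
  subtree S G = rooted (vertices S) && (induced G (vertices S) == S).
Proof.
apply/idP/andP => [/and3P[sSG /set0Pn[x0 x0S] cS]|[rS /eqP <-]].
  have [/= _ /subsetP sE] := andP sSG.
  split.
    pose r := [arg min_(i < x0 in vertices S) (i : nat)].
    have [rV rmin] : r \in vertices S /\ forall x, x \in vertices S -> r <= x.
      by rewrite /r; case: arg_minnP.
    apply/existsP; exists r; rewrite rV; apply/forall_inP => x xV.
    have [//|xr /=] := eqVneq x r.
    have rx : r < x by rewrite ltn_neqAle eq_sym xr rmin.
    rewrite rx; have /edge_subset/subsetP := edge_to_parent sSG cS rV xV rx.
    by apply; rewrite set22.
  apply/eqP/val_inj; rewrite /= [RHS]surjective_pairing; congr pair.
  apply/setP => e; rewrite inE; apply/andP/idP => [[]|eS]; last first.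
    by split; [apply: sE | apply: edge_subset].
  case/parent_tree_edgeP => x x_gt0 -> /subsetP sV.
  by apply: (@edge_to_parent S (p x)) => //; rewrite ?sV ?set21 ?set22 ?p_lt.
rewrite /subtree; have /exists_inP[r rV /forall_inP rP] := rS.
set W := vertices S in rV rP *.
apply/and3P; split; last 1 first.
- have to_r x : x \in W -> connect (adj (induced G W)) x r.
    elim/ltn_ind: {x}(val x) {-2}x (erefl (val x)) => i IH x xi xW.
    have /orP[/eqP->//|/andP[rx pxW]] := rP x xW.
    have x0 : 0 < x by apply: leq_ltn_trans rx.
    apply: connect_trans (IH (p x) _ _ (erefl _) pxW); last by rewrite -xi p_lt.
    apply: connect1; rewrite /adj inE; apply/andP; split.
      by apply/parent_tree_edgeP; exists x.
    by apply/subsetP => y; rewrite !inE => /orP[] /eqP->.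
  apply/forall_inP => x xW; apply/forall_inP => y yW.
  apply: connect_trans (to_r x xW) _.
  by rewrite sym_connect_sym; [apply: to_r | apply: adj_sym].
- by rewrite /subgraph subsetT; apply/subsetP => e; rewrite inE => /andP[].
- by apply/set0Pn; exists r.
Qed.

Lemma rooted_subtree_sum (F : {set 'I_N.+1} -> nat) :
  \sum_(S : sgraph 'I_N.+1 | subtree S G) F (vertices S)
    = \sum_(W | rooted W) F W.
Proof.
rewrite [RHS](reindex_onto (@vertices 'I_N.+1) (induced G)) //.
by apply: eq_bigl => S; rewrite subtree_rooted.
Qed.

(** A cycle of length at least three is impossible, because the two distinct
neighbours on the cycle of its largest vertex would both be its parent. *)
Lemma parent_tree_is_tree : is_tree G.
Proof.
have: subtree G G.
  rewrite subtree_rooted; apply/andP; split.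
    apply/exists_inP; exists ord0; rewrite ?inE //.
    by apply/forall_inP => x _; rewrite !inE andbT -val_eqE /= lt0n orbN.
  apply/eqP/val_inj; congr pair.
  by apply/setP => e; rewrite inE subsetT andbT.
case/and3P => _ G0 Gc; split=> // s s3 /andP[cs us].
have [x0 x0s] : exists x, x \in s by case: s s3 {cs us} => // x s; exists x; rewrite mem_head.
pose x := [arg max_(i > x0 in s) (i : nat)].
have [xs xmax] : x \in s /\ forall y, y \in s -> y <= x.
  by rewrite /x; case: arg_maxnP.
have nbr y : y \in s -> adj G x y -> y = p x.
  move=> /xmax yx /parent_tree_adjP[[_ //]|[/p_lt py xy]].
  by move: py; rewrite -xy ltnNge yx.
have [i s' es] := rot_to xs.
move: cs us s3; rewrite -(rot_cycle i) -(rot_uniq i) -(size_rot i) es.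
case: s' es => // y s'; case/lastP: s' => // s' z es.
rewrite /= rcons_path last_rcons => /and3P[xy _ zx] /and3P[_ yz _] _.
have mem u : u \in rot i s -> u \in s by rewrite mem_rot.
have yp : y = p x by apply: nbr => //; apply: mem; rewrite es !inE eqxx orbT.
have zp : z = p x.
  apply: nbr; last by rewrite adj_sym.
  by apply: mem; rewrite es !inE mem_rcons mem_head !orbT.
by rewrite yp zp mem_rcons mem_head in yz.
Qed.

(** With at most two vertices every vertex is a leaf, and removing the leaves
gives the empty path. *)
Lemma small_parent_tree_caterpillar : N <= 1 -> caterpillar G.
Proof.
move=> N1; split; first exact: parent_tree_is_tree.
have lT : leaves G = setT.
  apply/setP => x; rewrite !inE; apply: leq_trans N1.
  rewrite -ltnS -[X in _ < X]card_ord -cardsT; apply: proper_card.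
  rewrite properT; apply: contraTneq isT => /setP/(_ x); rewrite !inE /=.
  by move/parent_tree_adjP; case=> -[/parent_neq /eqP].
exists [::]; split=> //=; rewrite /vertices /edges /= lT.
  by rewrite setDT set_nil.
apply/setP => e; rewrite !inE; apply/negP => /andP[/parent_tree_edgeP[x _ ->]].
by move/pred0P/(_ x); rewrite /= !inE eqxx.
Qed.

End ParentTree.


(** * Double brooms *)

Section DoubleBroom.
Variables (q a b N : nat).
Hypothesis N_def : N = q + a + b.
Notation V := 'I_N.+1.

(** The spine is [0, ..., q], the leaves at [0] are [q + 1, ..., q + a], and the
leaves at [q] are the vertices above [q + a]. *)
Definition broom_parent_nat (x : nat) : nat :=
  if x <= q then x.-1 else if x <= q + a then 0 else q.

Definition broom_parent (x : V) : V := inord (broom_parent_nat x).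

Lemma broom_parentE (x : V) : broom_parent x = broom_parent_nat x :> nat.
Proof.
rewrite inordK // /broom_parent_nat.
have := ltn_ord x; repeat case: ifP; lia.
Qed.

Lemma broom_parent_lt (x : V) : 0 < x -> broom_parent x < x.
Proof. by rewrite broom_parentE /broom_parent_nat; repeat case: ifP; lia. Qed.

Lemma broom_parent_root : broom_parent ord0 = ord0.
Proof. by apply: ord_inj; rewrite broom_parentE. Qed.

Definition double_broom : sgraph V := parent_tree broom_parent_lt.

Lemma inord_lt (i : nat) : i <= N -> (inord i : V) = i :> nat.
Proof. by move=> iN; rewrite /= inordK. Qed.

(** With leaves attached at both ends, every spine vertex has two neighbours,
even when the spine is a single vertex. *)
Lemma double_broom_leaves :
  0 < a -> 0 < b -> leaves double_broom = [set x : V | q < x].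
Proof.
move=> a0 b0; apply/setP => x; rewrite !inE /=; apply/idP/idP; last first.
  move=> qx; rewrite -(cards1 (broom_parent x)); apply/subset_leq_card/subsetP => y.
  rewrite !inE => /parent_tree_adjP[[_ ->]//|[y0 xy]].
  by move: qx; rewrite xy broom_parentE /broom_parent_nat; repeat case: ifP; lia.
rewrite /vdegree; apply: contraLR; rewrite -leqNgt -ltnNge => xq.
(* On each side of x, the next spine vertex or, at an end, the first leaf
   attached there. *)
pose y1 : V := inord (if x == 0 :> nat then q.+1 else x.-1).
pose y2 : V := inord (if x == q :> nat then (q + a).+1 else x.+1).
have y1E : y1 = (if x == 0 :> nat then q.+1 else x.-1) :> nat.
  by rewrite inord_lt //; case: ifP; lia.
have y2E : y2 = (if x == q :> nat then (q + a).+1 else x.+1) :> nat.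
  by rewrite inord_lt //; case: ifP; lia.
have y12 : y1 != y2.
  by rewrite -val_eqE /= y1E y2E; repeat case: ifP; lia.
rewrite -(_ : #|[set y1; y2]| = 2); last by rewrite cards2 y12.
apply/subset_leq_card/subsetP => y; rewrite !inE => /orP[] /eqP ->;
  apply/parent_tree_adjP.
- case: ifP y1E => x0 y1E; [right|left]; split.
  + by rewrite y1E.
  + by apply: ord_inj; rewrite broom_parentE /broom_parent_nat y1E; repeat case: ifP; lia.
  + by lia.
  + by apply: ord_inj; rewrite broom_parentE /broom_parent_nat y1E; repeat case: ifP; lia.
- right; split; first by rewrite y2E; case: ifP.
  by apply: ord_inj; rewrite broom_parentE /broom_parent_nat y2E; repeat case: ifP; lia.
Qed.

Lemma double_broom_caterpillar : 0 < a -> 0 < b -> caterpillar double_broom.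
Proof.
move=> a0 b0; split; first exact: parent_tree_is_tree broom_parent_root.
pose spine : seq V := mkseq inord q.+1.
have valK i : i <= q -> (inord i : V) = i :> nat by move=> iq; apply: inord_lt; lia.
have zipE : zip spine (behead spine)
          = mkseq (fun i => (inord i, inord i.+1) : V * V) q.
  have -> : behead spine = mkseq (fun i => inord i.+1) q.
    by rewrite /spine /mkseq /= (iotaDl 1 0) -map_comp.
  apply: (@eq_from_nth _ (ord0, ord0)) => [|i]; rewrite size_zip !size_mkseq.
    lia.
  move=> iq; rewrite nth_zip_cond size_zip !size_mkseq iq !nth_mkseq //; lia.
exists spine; rewrite zipE; split.
- apply/mkseq_uniqP => i j; rewrite !inE => iq jq /(congr1 (@nat_of_ord N.+1)).
  by rewrite !valK.
- rewrite {1}/vertices /= double_broom_leaves //; apply/setP => x; rewrite in_setD !in_set.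
  rewrite andbT -leqNgt; rewrite /spine /mkseq; apply/idP/mapP => [xq|[i]].
    by exists (x : nat); rewrite ?mem_iota ?inord_val //=; lia.
  by rewrite mem_iota => iq ->; rewrite valK; lia.
- rewrite /edges [LHS]/= double_broom_leaves //.
  apply/setP => e; rewrite !in_set -map_comp; apply/andP/mapP => [[]|[i]].
    case/parent_tree_edgeP => x x0 -> /pred0P/(_ x); rewrite /= !inE eqxx /=.
    move/negbT; rewrite -leqNgt => xq; exists x.-1; first by rewrite mem_iota; lia.
    have x1 : x.-1.+1 = x by lia.
    rewrite /= setUC x1 inord_val; congr [set _; _].
    by apply: ord_inj; rewrite broom_parentE /broom_parent_nat xq valK //; lia.
  rewrite mem_iota => iq ->; split.
    apply/parent_tree_edgeP; exists (inord i.+1) => /=; first by rewrite valK; lia.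
    rewrite setUC; congr [set _; _]; apply: ord_inj.
    by rewrite broom_parentE /broom_parent_nat !valK; (try case: ifP); lia.
  apply/pred0P => y; rewrite /= !inE; apply/negP => /andP[/orP[] /eqP ->];
    rewrite valK; lia.
Qed.

End DoubleBroom.


(** * Finite sums *)

(** A parametrization bounds a sum from above as soon as it is surjective; this
avoids proving that the descriptions of subtrees below are unique. *)
Lemma leq_sum_cover (I J : finType) (P : pred I) (Q : pred J) (F : J -> I)
    (g : I -> nat) :
  (forall i, P i -> exists2 j, Q j & F j = i) ->
  \sum_(i | P i) g i <= \sum_(j | Q j) g (F j).
Proof.
move=> cover; rewrite [leqRHS](partition_big F predT) //= big_mkcond.
apply: leq_sum => i _; case: ifP => // /cover[j Qj <-].
by rewrite (bigD1 j) ?Qj ?eqxx //= leq_addr.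
Qed.

Lemma card_ord_interval n i j :
  j <= n -> #|[set x : 'I_n | i <= x < j]| = j - i.
Proof.
move=> jn; rewrite -[RHS]muln1 -sum_nat_const_nat.
rewrite (big_nat_widen _ _ _ _ _ jn) (big_nat_widenl _ _ _ _ _ (leq0n i)).
rewrite big_mkord -sum1_card; apply: eq_bigl => x.
by rewrite inE /= andbC.
Qed.

(** * Rooted sets of a double broom *)

Section DoubleBroomCount.
Variables (q a b N : nat).
Hypothesis N_def : N = q + a + b.
Notation V := 'I_N.+1.
Notation p := (@broom_parent q a N).
Notation broom_rooted := (rooted p).

Let spine : {set V} := [set x : V | x <= q].
Let lleaves : {set V} := [set x : V | q.+1 <= x < (q + a).+1].
Let rleaves : {set V} := [set x : V | (q + a).+1 <= x < N.+1].
Let far : V := inord q.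

Let pE (x : V) : p x = broom_parent_nat q a x :> nat.
Proof. exact: broom_parentE N_def x. Qed.

Let farE : far = q :> nat.
Proof. by rewrite inordK //; lia. Qed.

(** Along the spine the parent is the predecessor, so the spine part of a rooted
set goes down from any of its elements to the root without a gap. *)
Lemma rooted_descent (W : {set V}) (r x y : V) :
  (forall x, x \in W -> (x == r) || (r < x) && (p x \in W)) ->
  x \in W -> x <= q -> r <= y <= x -> y \in W.
Proof.
move=> rW; elim/ltn_ind: {x}(val x) {-2}x (erefl (val x)) => i IH x xi xW xq.
case/andP => ry yx; have [->//|yNx] := eqVneq y x.
have {yNx} yx' : y < x by rewrite ltn_neqAle yx andbT.
have /orP[/eqP xr|/andP[rx pxW]] := rW x xW; first by move: yx'; rewrite xr; lia.
have px : p x = x.-1 :> nat by rewrite pE /broom_parent_nat xq.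
move: xi => /= xi; by apply: (IH (p x) _ (p x) (erefl _) pxW); rewrite px; lia.
Qed.

Lemma parent_of_leaf (x : V) :
  q < x -> p x = if x \in lleaves then ord0 else far.
Proof.
move=> qx; apply: ord_inj; rewrite pE /broom_parent_nat !inE.
by repeat case: ifP; rewrite ?farE /=; lia.
Qed.

Lemma rooted_spine (W : {set V}) : spine \subset W -> broom_rooted W.
Proof.
move=> /subsetP sW; apply/exists_inP; exists ord0; first by apply: sW; rewrite inE.
apply/forall_inP => x xW; have [//|x0 /=] := eqVneq x ord0.
have {}x0 : 0 < x by rewrite lt0n.
rewrite x0; apply: sW; rewrite inE pE /broom_parent_nat.
by repeat case: ifP; lia.
Qed.

Lemma rooted_both_ends (W : {set V}) :
  broom_rooted W -> ord0 \in W -> far \in W -> spine \subset W.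
Proof.
move=> /exists_inP[r rW /forall_inP rP] W0 Wf.
have r0 : r = 0 :> nat by have /orP[/eqP<-|/andP[]] := rP _ W0.
apply/subsetP => x; rewrite inE => xq.
by apply: (rooted_descent rP Wf); rewrite farE; lia.
Qed.

(** With [0] in [W], the root is [0] and the spine part of [W] is an initial
segment; a leaf at the other end would bring its parent [far] into [W]. *)
Lemma rooted_near_end (W : {set V}) :
  broom_rooted W && ((ord0 \in W) && (far \notin W)) ->
  exists2 j : 'I_q.+1 * {set V}, (0 < j.1) && (j.2 \subset lleaves)
    & [set x : V | 0 <= x < j.1] :|: j.2 = W.
Proof.
move=> /and3P[/exists_inP[r rW /forall_inP rP] W0 Wf].
have r0 : r = ord0.
  by apply: ord_inj; have /orP[/eqP<-|/andP[]] := rP _ W0.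
(* The segment stops at the first spine vertex m missing from W. *)
have exm : exists i, (inord i : V) \notin W by exists q.
have [m mW mmin] := ex_minnP exm.
have mq : m <= q by apply: mmin.
have m0 : 0 < m.
  rewrite lt0n; apply: contraNneq mW => ->.
  by rewrite (_ : inord 0 = ord0) //; apply: ord_inj; rewrite inordK.
exists (Ordinal (mq : m < q.+1), W :&: lleaves); first by rewrite m0 subsetIr.
apply/setP => x; rewrite !inE /=; have [xq|qx] := leqP x q.
  rewrite andbF orbF; apply/idP/idP => [xm|xW].
    apply: contraLR xm => xW; rewrite -leqNgt; apply: mmin.
    by rewrite inord_val.
  rewrite ltnNge; apply: contra mW => mx.
  by apply: (rooted_descent rP xW xq); rewrite r0 inordK //; lia.
have -> : (x < m) = false by lia.
rewrite /= andbC; have [xl|xl] := ltnP x (q + a).+1; first by [].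
apply/esym/negbTE; apply: contra Wf => xW.
have xN0 : (x == r) = false by rewrite r0 -val_eqE /=; lia.
have := rP x xW; rewrite xN0 /= => /andP[_].
by rewrite parent_of_leaf // inE qx /= ltnNge xl.
Qed.

(** The mirror case: the spine part of [W] is the final segment starting at the
root, and the leaves at [0] are excluded because the root is not [0]. *)
Lemma rooted_far_end (W : {set V}) :
  broom_rooted W && ((ord0 \notin W) && (far \in W)) ->
  exists2 j : 'I_q.+1 * {set V}, (0 < j.1) && (j.2 \subset rleaves)
    & [set x : V | j.1 <= x < q.+1] :|: j.2 = W.
Proof.
move=> /and3P[/exists_inP[r rW /forall_inP rP] W0 Wf].
have r0 : 0 < r.
  rewrite lt0n; apply: contraNneq W0 => r0.
  by rewrite (_ : ord0 = r) //; apply: ord_inj.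
have rq : r <= q.
  by have /orP[/eqP<-|/andP[+ _]] := rP _ Wf; rewrite farE //; lia.
have rmin x : x \in W -> r <= x by case/rP/orP => [/eqP->//|/andP[/ltnW]].
exists (Ordinal (rq : r < q.+1), W :&: rleaves); first by rewrite r0 subsetIr.
apply/setP => x; rewrite !inE /= ltnS; have [xq|qx] := leqP x q.
  rewrite andbT (_ : (q + a < x) = false) ?andbF ?orbF; last by lia.
  apply/idP/idP => [rx|/rmin//].
  by apply: (rooted_descent rP Wf); rewrite farE //; lia.
rewrite andbF /= ltn_ord andbT andbC.
have [xl|xl] := ltnP (q + a) x; first by [].
apply/esym/negbTE; apply: contra W0 => xW.
have xNr : (x == r) = false by rewrite -val_eqE /=; lia.
have := rP x xW; rewrite xNr /= => /andP[_].
by rewrite parent_of_leaf // inE qx /= ltnS xl.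
Qed.

(** A leaf of [W] must be the root, since neither possible parent is in [W].  A
root on the leaves thus gives a singleton, a root on the spine a segment. *)
Lemma rooted_no_end (W : {set V}) :
  broom_rooted W && ((ord0 \notin W) && (far \notin W)) ->
  exists2 j : V * 'I_q.+1, true
    & (if j.1 <= q then [set x : V | j.2 <= x <= j.1] else [set j.1]) = W.
Proof.
move=> /and3P[/exists_inP[r rW /forall_inP rP] W0 Wf].
have leafr x : x \in W -> q < x -> x = r.
  move=> xW qx; have /orP[/eqP//|/andP[_]] := rP x xW.
  by rewrite parent_of_leaf //; case: ifP => _; rewrite ?(negbTE W0) ?(negbTE Wf).
have rmin x : x \in W -> r <= x by case/rP/orP => [/eqP->//|/andP[/ltnW]].
have [rq|qr] := leqP r q; last first.
  (* A singleton is determined by r; ord0 is a default value. *)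
  exists (r, ord0) => //=; rewrite leqNgt qr /=; apply/setP => x; rewrite inE.
  apply/eqP/idP => [->//|xW]; apply: leafr => //.
  exact: leq_trans qr (rmin x xW).
have Wq x : x \in W -> x <= q.
  by move=> xW; rewrite leqNgt; apply/negP => qx; move: rq; rewrite -(leafr x xW qx) leqNgt qx.
pose m := [arg max_(x > r in W) (x : nat)].
have [mW mmax] : m \in W /\ forall x, x \in W -> x <= m.
  by rewrite /m; case: arg_maxnP.
exists (m, Ordinal (rq : r < q.+1)) => //=; rewrite Wq //.
apply/setP => x; rewrite inE; apply/idP/idP => [|xW].
  by apply: (rooted_descent rP mW); apply: Wq.
by rewrite rmin ?mmax.
Qed.

Lemma card_lleaves : #|lleaves| = a.
Proof. by rewrite card_ord_interval; lia. Qed.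

Lemma card_rleaves : #|rleaves| = b.
Proof. by rewrite card_ord_interval; lia. Qed.

Lemma card_spine : #|spine| = q.+1.
Proof. by rewrite -[RHS]subn0 -(@card_ord_interval N.+1) //; lia. Qed.

Lemma card_spine_supersets :
  \sum_(W : {set V} | spine \subset W) 1 = 2 ^ (a + b).
Proof.
rewrite sum1dep_card (_ : a + b = #|~: spine|); last first.
  by have := cardsC spine; rewrite card_spine card_ord; lia.
rewrite -card_powerset -[RHS](card_imset _ (@setC_inj V)); congr #|pred_of_set _|.
apply/setP => W; rewrite in_set; apply/idP/imsetP => [sW|[X]].
  by exists (~: W); rewrite ?setCK // powersetE setCS.
by rewrite powersetE => sX ->; rewrite -setCS setCK.
Qed.

(** Complementing the set of leaves pairs each superset of the spine with one
such that both orders add up to the number of vertices plus that of the spine. *)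
Lemma sum_spine_supersets :
  2 * (\sum_(W : {set V} | spine \subset W) #|W|)
    = 2 ^ (a + b) * (N.+1 + q.+1).
Proof.
pose flip (W : {set V}) := spine :|: ~: W.
have flipK (W : {set V}) : spine \subset W -> flip (flip W) = W.
  move=> sW; rewrite /flip setCU setCK setUIr setUCr setTI.
  exact/setUidPr.
rewrite mulSn mul1n {2}(reindex_onto flip flip) //=.
rewrite [X in _ + X](eq_bigl (fun W : {set V} => spine \subset W)) => [|W]; last first.
  rewrite {1}/flip subsetUl /=; apply/eqP/idP => [<-|/flipK//]; exact: subsetUl.
rewrite -big_split -card_spine_supersets big_distrl /=.
apply: eq_bigr => W sW; rewrite mul1n -cardsUI addnC /flip.
rewrite setUCA setUCr setUT cardsT card_ord setIUr setICr setU0.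
by rewrite (setIidPr sW) card_spine addnC.
Qed.

Lemma sum_const_pairs (L : {set V}) (f : nat -> nat) :
  \sum_(j : 'I_q.+1 * {set V} | (0 < j.1) && (j.2 \subset L)) f j.1
    = 2 ^ #|L| * \sum_(1 <= i < q.+1) f i.
Proof.
rewrite -(pair_big (fun i : 'I_q.+1 => 0 < i) (fun X : {set V} => X \subset L)
                   (fun i _ => f i)) /=.
rewrite (big_nat_widenl _ _ _ _ _ (leq0n 1)) big_mkord big_distrr /=.
apply: eq_bigr => i _; rewrite -card_powerset -sum_nat_const.
by apply: eq_bigl => X; rewrite powersetE.
Qed.

(** Truncated subtraction is the right deficit: it bounds the loss from
above, and sets larger than [t] only help. *)
Lemma deficit_near_end (t : nat) :
  \sum_(W | broom_rooted W && ((ord0 \in W) && (far \notin W))) (t - #|W|)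
    <= 2 ^ a * \sum_(1 <= i < q.+1) (t - i).
Proof.
rewrite -[X in _ <= 2 ^ X * _]card_lleaves -(sum_const_pairs _ (fun i => t - i)).
apply: leq_trans (leq_sum_cover (fun W : {set V} => t - #|W|) rooted_near_end) _.
apply: leq_sum => j _; apply: leq_sub2l.
apply: leq_trans (subset_leq_card (subsetUl _ _)).
rewrite card_ord_interval ?subn0 //.
by apply: leq_trans (ltnW (ltn_ord j.1)) _; lia.
Qed.

(** A segment starting at [i] has [q + 1 - i] vertices, whence the reversal of
the sum. *)
Lemma deficit_far_end (t : nat) :
  \sum_(W | broom_rooted W && ((ord0 \notin W) && (far \in W))) (t - #|W|)
    <= 2 ^ b * \sum_(1 <= i < q.+1) (t - i).
Proof.
rewrite big_nat_rev -[X in _ <= 2 ^ X * _]card_rleaves.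
rewrite -(sum_const_pairs _ (fun i => t - (1 + q.+1 - i.+1))).
apply: leq_trans (leq_sum_cover (fun W : {set V} => t - #|W|) rooted_far_end) _.
apply: leq_sum => j _; apply: leq_sub2l.
apply: leq_trans (subset_leq_card (subsetUl _ _)).
by rewrite card_ord_interval; lia.
Qed.

Lemma deficit_no_end (t : nat) :
  \sum_(W | broom_rooted W && ((ord0 \notin W) && (far \notin W))) (t - #|W|)
    <= N.+1 * q.+1 * t.
Proof.
apply: leq_trans (leq_sum_cover (fun W : {set V} => t - #|W|) rooted_no_end) _.
apply: (@leq_trans (\sum_(j : V * 'I_q.+1) t)).
  by apply: leq_sum => j _; apply: leq_subr.
by rewrite sum_nat_const card_prod !card_ord.
Qed.

(** The first hypothesis says that the sets containing the spine have mean order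
at least [t + 1], so each of the [2 ^ (a + b)] of them is worth a surplus of one
over [t] on average; the second says that this surplus exceeds the total deficit
of all the other rooted sets. *)
Lemma broom_sum_gt (t : nat) :
  2 * t <= 2 * q + a + b ->
  (2 ^ a + 2 ^ b) * (\sum_(1 <= i < q.+1) (t - i)) + N.+1 * q.+1 * t
    < 2 ^ (a + b) ->
  t * (\sum_(W | broom_rooted W) 1) < \sum_(W | broom_rooted W) #|W|.
Proof.
move=> t_le few.
pose full (W : {set V}) := spine \subset W.
rewrite (bigID full) [ltnRHS](bigID full) /= mulnDr.
have fullE (f : {set V} -> nat) :
    \sum_(W | broom_rooted W && full W) f W = \sum_(W | full W) f W.
  by apply: eq_bigl => W; rewrite andb_idl //; apply: rooted_spine.
rewrite !fullE; set rest := fun W => broom_rooted W && ~~ full W.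
have restP : t * (\sum_(W | rest W) 1)
    <= \sum_(W | rest W) #|W| + \sum_(W | rest W) (t - #|W|).
  by rewrite -big_split big_distrr /=; apply: leq_sum => W _; lia.
have deficit : \sum_(W | rest W) (t - #|W|)
    <= (2 ^ a + 2 ^ b) * (\sum_(1 <= i < q.+1) (t - i)) + N.+1 * q.+1 * t.
  have nfull W : broom_rooted W -> full W = (ord0 \in W) && (far \in W).
    move=> rW; apply/idP/andP => [/subsetP sW|[]]; last exact: rooted_both_ends.
    by split; apply: sW; rewrite inE ?farE.
  rewrite mulnDl; apply: leq_trans _ (leq_add (leq_add
    (deficit_near_end t) (deficit_far_end t)) (deficit_no_end t)).
  rewrite [leqLHS]big_mkcond [X in _ <= X + _ + _]big_mkcond.
  rewrite [X in _ <= _ + X + _]big_mkcond [X in _ <= _ + X]big_mkcond.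
  rewrite -!big_split; apply: leq_sum => W _; rewrite /rest /=.
  have := nfull W; case: (broom_rooted W) => //= -> //.
  by case: (ord0 \in W); case: (far \in W) => //=; rewrite ?addn0.
have full_sum : 2 * (\sum_(W | full W) #|W|) = _ := sum_spine_supersets.
have full_card : \sum_(W | full W) 1 = _ := card_spine_supersets.
rewrite full_card; set F := 2 ^ (a + b) in full_sum few *.
have full_avg : F * (2 * t + 2) <= F * (N.+1 + q.+1) by apply: leq_mul => //; lia.
rewrite -full_sum mulnDr in full_avg.
have {deficit few} := leq_ltn_trans deficit few.
change (\sum_(W | rest W) (t - #|W|) < F ->
  t * F + t * (\sum_(W | rest W) 1)
    < \sum_(W | full W) #|W| + \sum_(W | rest W) #|W|).
move: F full_sum full_avg => F; clear -restP; lia.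
Qed.

End DoubleBroomCount.


(** * The mean subtree order *)

Lemma mean_double_broom_gt (R : numFieldType) (q a b N t : nat)
    (N_def : N = q + a + b) :
  2 * t <= 2 * q + a + b ->
  (2 ^ a + 2 ^ b) * (\sum_(1 <= i < q.+1) (t - i)) + N.+1 * q.+1 * t
    < 2 ^ (a + b) ->
  (t%:R < mean_subtree_order R (double_broom N_def))%R.
Proof.
move=> t_le few; have := broom_sum_gt N_def t_le few.
set p_lt := broom_parent_lt N_def.
have p_root := broom_parent_root N_def.
rewrite -!(rooted_subtree_sum p_lt p_root) sum1dep_card => sum_gt.
rewrite /mean_subtree_order -natr_sum.
have [card0|card_gt0] := posnP #|[set S | subtree S (double_broom N_def)]|.
  move: sum_gt; rewrite big_pred0 // => S.
  by move/cards0_eq/setP/(_ S): card0; rewrite !inE.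
by rewrite ltr_pdivlMr ?ltr0n // -natrM ltr_nat.
Qed.

Lemma sum_decreasing (q s : nat) :
  2 * (\sum_(1 <= i < q.+1) (q + s - i)) = q * (q + 2 * s - 1).
Proof.
elim: q s => [|q IH] s; first by rewrite big_geq.
rewrite big_nat_recr //= mulnDr.
rewrite (eq_big_nat _ _ (F2 := fun i => q + s.+1 - i)) => [|i _]; last by lia.
by rewrite IH; case: q {IH} => [|q]; lia.
Qed.

Lemma mul_pred_lt_exp2 n : n * n.-1 < 2 ^ n.
Proof.
case: n => // n; elim: n => // -[|[|n]] // /= IH; rewrite expnS.
move: (2 ^ n.+3) IH => X; nia.
Qed.

(** The choice of the double broom.  Up to order two [n - s.+1] is zero and any
small tree will do; the double brooms used from order three on have leaves at
both ends. *)
Lemma caterpillar_mean_nat (R : numFieldType) (n s : nat) :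
  1 <= n -> n ^ 2 <= 2 ^ s ->
  exists (T : finType) (C : sgraph T),
    [/\ caterpillar C, graph_order C = n
      & ((n - s.+1)%:R < mean_subtree_order R C)%R].
Proof.
move=> n1 ns; set t := n - s.+1.
have order N q a b (e : N = q + a + b) : graph_order (double_broom e) = N.+1.
  by rewrite /graph_order cardsT card_ord.
have [n2|n3] := leqP n 2.
  have e : n.-1 = n.-1 + 0 + 0 by rewrite !addn0.
  exists 'I_n.-1.+1, (double_broom e); split.
  - apply: small_parent_tree_caterpillar (broom_parent_root e) _; lia.
  - by rewrite order prednK.
  - have t0 : t = 0 by case: s ns @t => [|s]; nia.
    apply: mean_double_broom_gt; rewrite t0 ?muln0 // addn0.
    by rewrite big1.
have s1 : 0 < s by case: s ns {t} => // ns; nia.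
have [n_le|n_gt] := leqP n (2 * s).
  (* The star: its leaves are split as n - 2 and 1 only so that both ends,
     here the same vertex, carry some. *)
  have e : n.-1 = 0 + (n - 2) + 1 by lia.
  exists 'I_n.-1.+1, (double_broom e); split.
  - apply: double_broom_caterpillar; lia.
  - by rewrite order prednK.
  - apply: mean_double_broom_gt; first by rewrite /t; lia.
    rewrite big_geq // muln0 muln1 prednK //.
    rewrite (_ : n - 2 + 1 = n.-1); last by lia.
    rewrite -(ltn_pmul2l (isT : 0 < 2)) -expnS prednK //.
    apply: leq_ltn_trans (mul_pred_lt_exp2 n).
    by rewrite mulnCA leq_mul2l; apply/orP; right; rewrite /t; lia.
(* All vertices but the 2s leaves form the spine 0, ..., q. *)
set q := n - (2 * s).+1.
have e : n.-1 = q + s + s by rewrite /q; lia.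
exists 'I_n.-1.+1, (double_broom e); split.
- apply: double_broom_caterpillar; lia.
- by rewrite order prednK.
- have tE : t = q + s by rewrite /t /q; lia.
  apply: mean_double_broom_gt; first by lia.
  rewrite prednK // tE addnn -muln2 -mulnA sum_decreasing expnD.
  set X := 2 ^ s in ns *.
  have ends : q * (q + 2 * s - 1) + n <= X by nia.
  have rest : n * q.+1 * (q + s) < n * X by nia.
  by nia.
Qed.

Lemma sqr_le_exp2_ceil (R : realType) (n : nat) : 1 <= n ->
  exists2 s : nat, n ^ 2 <= 2 ^ s
    & Num.ceil (2 * log2 (n%:R : R))%R = s%:Z.
Proof.
move=> n1; set x : R := (2 * log2 n%:R)%R.
have n0 : (0 < n%:R :> R)%R by rewrite ltr0n.
have ln2 : (0 < ln 2 :> R)%R by rewrite ln_gt0 // ltr1n.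
have x0 : (0 <= x)%R.
  by rewrite mulr_ge0 // divr_ge0 ?(ltW ln2) // ln_ge0 // ler1n.
have c0 : (0 <= Num.ceil x)%R by rewrite ceil_ge0 (lt_le_trans _ x0) // ltrN10.
exists `|Num.ceil x|%N; last by rewrite gez0_abs.
rewrite -(ler_nat R) !natrX -ler_ln ?posrE ?exprn_gt0 //.
rewrite !lnXn // -[leLHS]mulr_natl -[leRHS]mulr_natl -ler_pdivrMr //.
by rewrite -mulrA natr_absz ger0_norm // ceil_ge.
Qed.

Local Close Scope nat_scope.

Theorem corollary4p3 (R : realType) (n : nat) (hn : (1 <= n)%N) :
  exists (T : finType) (C : sgraph T),
    [/\ caterpillar C,
        graph_order C = n &
        mean_subtree_order R C
          > n%:R - (Num.ceil (2 * log2 (n%:R : R)))%:~R - 1].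
Proof.
have [s ns ->] := sqr_le_exp2_ceil R hn.
have [T [C [catC orderC meanC]]] := caterpillar_mean_nat R hn ns.
exists T, C; split=> //; apply: le_lt_trans meanC.
by rewrite -addrA -opprD -pmulrn natr1 lerBlDr -natrD ler_nat; lia.
Qed.
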